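(* Let $M$ be a finitely generated $\mathbb{Z}^r$-graded $S$-module, let $\mathbf{v}\in\mathbb{Z}^r$ be a positive coarsening vector and let $d$ be a positive integer. Then, for every $i\ge 0$, $$\mathcal{D}_{i,d\mathbf{v}}(M)=\mathcal{D}_{i,\mathbf{v}}(M).$$
   Context: Let $K$ be a field and $S=K[x_1,\ldots,x_n]$, with a $\mathbb{Z}^r$-grading given by $\deg(x_i)=\mathbf{a}_i\in\mathbb{Z}^r$. Let $Q\subseteq\mathbb{Z}^r$ be the subsemigroup (containing $0$) generated by $\mathbf{a}_1,\ldots,\mathbf{a}_n$. $S$ is assumed positively multigraded: $\deg(x_i)\ne 0$ for all $i$ and $Q$ has no nonzero invertible elements. A vector $\mathbf{v}\in\mathbb{Z}^r$ is a positive coarsening vector if $\deg_{\mathbf{v}}(x_i):=\mathbf{a}_i\cdot\mathbf{v}>0$ for all $i$. For a $\mathbb{Z}^r$-graded module $M$, $M^{[\mathbf{v}]}$ denotes $M$ with the $\mathbb{Z}$-grading $(M^{[\mathbf{v}]})_m=\bigoplus_{\mathbf{a}\cdot\mathbf{v}=m}M_{\mathbf{a}}$. Put $\mathfrak{m}=\langle x_1,\ldots,x_n\rangle$, $c_{\mathbf{v}}=\operatorname{lcm}(\deg_{\mathbf{v}}(x_1),\ldots,\deg_{\mathbf{v}}(x_n))$ and $s_{\mathbf{v}}=\max\{nc_{\mathbf{v}}-\sum_{i=1}^n\deg_{\mathbf{v}}(x_i),\ c_{\mathbf{v}}\}$. Define $$\operatorname{reg}_{\mathbf{v}}(M)=\{p\in\mathbb{Z}\mid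 H^i_{\mathfrak{m}}(M^{[\mathbf{v}]})_q=0\ \text{for all } i\ge 0 \text{ and all } q\in p+(1-i)c_{\mathbf{v}}+\mathbb{N}c_{\mathbf{v}}\},$$ where $\mathbb{N}$ contains $0$, and $\operatorname{reg-num}_{\mathbf{v}}(M)=\inf\{p\in\operatorname{reg}_{\mathbf{v}}(M)\mid q\in\operatorname{reg}_{\mathbf{v}}(M)\text{ for all } q\ge p\}$ (which is $-\infty$ if $M=0$). Fix finitely many $\mathbf{b}_1,\ldots,\mathbf{b}_k\in\mathbb{Z}^r$ such that $M_{\mathbf{a}}\neq 0$ implies $\mathbf{a}\in\bigcup_j(\mathbf{b}_j+Q)$ (such vectors exist for every finitely generated $M$), and for every positive coarsening vector $\mathbf{v}$ put $$\mathcal{D}_{i,\mathbf{v}}(M):=\Big\{\mathbf{a}\in\bigcup_j(\mathbf{b}_j+Q)\ \Big|\ \mathbf{a}\cdot\mathbf{v}\le\operatorname{reg-num}_{\mathbf{v}}(M)+i s_{\mathbf{v}}+c_{\mathbf{v}}-1\Big\}.$$ *)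

(* Defs.v *)
From HB Require Import structures.
From mathcomp Require Import all_boot all_order all_algebra.
(* [mpoly] has to come before the classical-set notations: in the other order
   the levels of their notations clash. *)
From mathcomp Require Import mpoly.
From mathcomp Require Import constructive_ereal boolp classical_sets.
Set Implicit Arguments.
Unset Strict Implicit.
Unset Printing Implicit Defensive.
Import Order.TTheory GRing.Theory Num.Theory.
Local Open Scope classical_set_scope.
Local Open Scope ring_scope.

Section GradedModules.
Variables (K : fieldType) (n : nat) (G : zmodType) (w : 'I_n -> G).
Local Notation S := {mpoly K[n]}.

Definition monomial_degree (m : 'X_{1..n}) : G := \sum_(i < n) w i *+ m i.

Definition homog_poly (g : G) : set S :=
  [set p | forall m, m \in msupp p -> monomial_degree m = g].

(* M is the internal direct sum of the additive subgroups H g, and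
   S_g M_h is contained in M_(g + h). *)
Record is_grading (M : lmodType S) (H : G -> set M) : Prop := IsGrading {
  grading0 : forall g, H g 0;
  gradingB : forall g x y, H g x -> H g y -> H g (x - y);
  gradingM : forall g h p x, homog_poly g p -> H h x -> H (g + h) (p *: x);
  grading_sum : forall x, exists2 xs : seq M,
    (forall y, y \in xs -> exists g, H g y) & x = \sum_(y <- xs) y;
  grading_direct : forall (s : seq G) (f : G -> M),
    uniq s -> (forall g, H g (f g)) -> \sum_(g <- s) f g = 0 ->
    forall g, g \in s -> f g = 0 }.

Record gmodule := GModule {
  gmodule_sort :> lmodType S;
  component : G -> set gmodule_sort;
  component_grading : is_grading component }.

End GradedModules.
Arguments component {K n G w} M g : rename.
Arguments gmodule K {n G} w.

Section LocalCohomology.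
Variables (K : fieldType) (n : nat) (G : zmodType) (w : 'I_n -> G).
Local Notation S := {mpoly K[n]}.
Local Notation gmod := (gmodule K w).

Definition finitely_generated (M : gmod) : Prop :=
  exists (l : nat) (e : 'I_l -> M),
    forall x : M, exists c : 'I_l -> S, x = \sum_(j < l) c j *: e j.

Definition graded_hom (A B : gmod) (f : {linear A -> B}) : Prop :=
  forall g x, component A g x -> component B g (f x).

Definition graded_injective (E : gmod) : Prop :=
  forall (A B : gmod) (f : {linear A -> B}) (h : {linear A -> E}),
    graded_hom f -> injective f -> graded_hom h ->
    exists2 h' : {linear B -> E}, graded_hom h' & forall x, h' (f x) = h x.

Record injective_resolution (M : gmod) := InjectiveResolution {
  res_mod :> nat -> gmod;
  res_aug : {linear M -> res_mod 0};
  res_diff : forall i, {linear res_mod i -> res_mod i.+1};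
  res_injective : forall i, graded_injective (res_mod i);
  res_aug_graded : graded_hom res_aug;
  res_diff_graded : forall i, graded_hom (res_diff i);
  res_aug_inj : injective res_aug;
  res_exact0 : forall x, res_diff 0 x = 0 <-> exists y, x = res_aug y;
  res_exactS : forall i x,
    res_diff i.+1 x = 0 <-> exists y, x = res_diff i y }.

Definition max_ideal : set S :=
  [set p | exists c : 'I_n -> S, p = \sum_(i < n) c i * 'X_i].

(* Gamma_m(E): the elements killed by some power m^t, where m^t is generated
   by the t-fold products of elements of m. *)
Definition torsion (E : gmod) : set E :=
  [set x | exists t : nat, forall p : 'I_t -> S,
     (forall j, max_ideal (p j)) -> (\prod_(j < t) p j) *: x = 0].

Definition torsion_cocycles (M : gmod) (E : injective_resolution M)
    (i : nat) (g : G) : set (E i) :=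
  [set x | [/\ torsion x, component (E i) g x & res_diff E i x = 0]].

Definition torsion_coboundaries (M : gmod) (E : injective_resolution M)
    (i : nat) (g : G) : set (E i) :=
  match i return set (E i) with
  | 0 => [set 0]
  | j.+1 => [set x | exists y, [/\ torsion y, component (E j) g y
                                 & x = res_diff E j y]]
  end.

Arguments torsion_cocycles {M} E i g.
Arguments torsion_coboundaries {M} E i g.

(* H^i_m(M)_g = 0, where H^i_m is the i-th right derived functor of Gamma_m on
   the category of graded modules and degree-preserving maps. This category has
   enough injectives and the cohomology of Gamma_m(E) does not depend on the
   resolution E, so quantifying over all E is the same as fixing one. *)
Definition local_cohomology_eq0 (M : gmod) (i : nat) (g : G) : Prop :=
  forall E : injective_resolution M,
    torsion_cocycles E i g `<=` torsion_coboundaries E i g.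

End LocalCohomology.

Section Coarsening.
Variables (K : fieldType) (n r : nat) (a : 'I_n -> 'rV[int]_r).
Local Notation S := {mpoly K[n]}.

Definition dotv (u v : 'rV[int]_r) : int := \sum_(j < r) u 0 j * v 0 j.

Definition degv (v : 'rV[int]_r) (i : 'I_n) : int := dotv (a i) v.

Definition coarse_component (M : gmodule K a) (v : 'rV[int]_r) (m : int) :
    set M :=
  [set x | exists2 xs : seq M,
     (forall y, y \in xs -> exists2 u, dotv u v = m & component M u y)
     & x = \sum_(y <- xs) y].

Lemma dotvD v : {morph dotv^~ v : x y / x + y}.
Proof.
by move=> x y; rewrite /dotv -big_split; apply: eq_bigr => j _;
  rewrite mxE mulrDl.
Qed.

Lemma dotv0 v : dotv 0 v = 0.
Proof. by rewrite /dotv big1 // => j _; rewrite mxE mul0r. Qed.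

Lemma dotvMn v x k : dotv (x *+ k) v = dotv x v *+ k.
Proof.
by elim: k => [|k IH]; rewrite ?mulr0n ?dotv0 // !mulrS dotvD IH.
Qed.

Lemma monomial_degree_degv v (m : 'X_{1..n}) :
  monomial_degree (degv v) m = dotv (monomial_degree a m) v.
Proof.
rewrite /monomial_degree (big_morph (dotv^~ v) (dotvD v) (dotv0 v)).
by apply: eq_bigr => i _; rewrite dotvMn.
Qed.

Section GradingLemmas.
Variable M : gmodule K a.
Local Notation H := (component M).
Let HP : is_grading a H := component_grading M.

Lemma componentN u x : H u x -> H u (- x).
Proof. by move=> hx; rewrite -sub0r; apply: (gradingB HP) => //; apply: (grading0 HP). Qed.

Lemma componentD u x y : H u x -> H u y -> H u (x + y).
Proof.
by move=> hx hy; rewrite -[y]opprK; apply: (gradingB HP) => //; apply: componentN.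
Qed.

(* Collecting the terms of equal degree in a sum of homogeneous elements. *)
Lemma coarse_collect v m (x : M) : coarse_component v m x ->
  exists (t : seq 'rV[int]_r) (F : 'rV[int]_r -> M),
  [/\ uniq t, forall u, u \in t -> dotv u v = m, forall u, H u (F u),
      forall u, u \notin t -> F u = 0 & x = \sum_(u <- t) F u].
Proof.
case=> xs; elim: xs x => [|y xs IH] x hxs ->.
  exists [::], (fun=> 0); split=> //; last by rewrite !big_nil.
  by move=> u; apply: (grading0 HP).
have hxs' z : z \in xs -> exists2 u, dotv u v = m & H u z.
  by move=> hz; apply: hxs; rewrite inE hz orbT.
have [t [F [ut ht hF F0 e]]] := IH _ hxs' erefl.
have [u0 du0 hy] := hxs y (mem_head _ _).
pose F' u := F u + (if u == u0 then y else 0).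
have hF' u : H u (F' u).
  apply: componentD => //; case: eqP => [->//|_]; exact: (grading0 HP).
have [u0t|u0t] := boolP (u0 \in t).
  exists t, F'; split=> //.
    move=> u hu; rewrite /F' F0 // add0r; case: eqP => // eu.
    by rewrite eu u0t in hu.
  rewrite big_cons e big_split /= addrC; congr (_ + _).
  rewrite (bigD1_seq u0) //= eqxx big1 ?addr0 // => u /negbTE -> //.
exists (u0 :: t), F'; split=> //=.
- by rewrite u0t.
- by move=> u; rewrite inE => /orP[/eqP->//|]; apply: ht.
- move=> u; rewrite inE negb_or => /andP[/negbTE hu hut].
  by rewrite /F' hu addr0 F0.
- rewrite !big_cons e /F' eqxx F0 // add0r; congr (_ + _).
  rewrite !big_seq; apply: eq_bigr => u hu; case: eqP => [eu|]; last first.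
    by rewrite addr0.
  by rewrite -eu hu in u0t.
Qed.

Lemma coarse_grading v : is_grading (degv v) (coarse_component (M := M) v).
Proof.
split.
- by move=> m; exists [::]; rewrite ?big_nil.
- move=> m x y [xs hxs ->] [ys hys ->].
  exists (xs ++ map -%R ys); last by rewrite big_cat big_map sumrN.
  move=> z; rewrite mem_cat => /orP[/hxs//|/mapP[z' /hys[u hu hz] ->]].
  by exists u => //; apply: componentN.
- move=> g h p x hp [xs hxs ->].
  exists [seq (p@_m *: 'X_[m]) *: y | m <- msupp p, y <- xs].
    move=> z /allpairsP[[m y] /= [hm hy ->]].
    have [u hu Hy] := hxs y hy.
    exists (monomial_degree a m + u).
      by rewrite dotvD hu -monomial_degree_degv hp.
    apply: (gradingM HP) => // m' hm'.
    have : m' \in msupp ('X_[m] : {mpoly K[n]}) by apply: msuppZ_le hm'.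
    by rewrite msuppX inE => /eqP->.
  rewrite big_allpairs_dep /= [in LHS](mpolyE p) scaler_suml.
  by apply: eq_bigr => m _; rewrite scaler_sumr.
- move=> x; have [xs hxs ->] := grading_sum HP x.
  exists xs => // y /hxs[u hu]; exists (dotv u v), [:: y].
    by move=> z; rewrite inE => /eqP->; exists u.
  by rewrite big_seq1.
- move=> s f us hf sf0.
  have /choice[tF htF] : forall m, exists tF : seq 'rV[int]_r * ('rV_r -> M),
      [/\ uniq tF.1, forall u, u \in tF.1 -> dotv u v = m,
          forall u, H u (tF.2 u), forall u, u \notin tF.1 -> tF.2 u = 0
        & f m = \sum_(u <- tF.1) tF.2 u].
    by move=> m; have [t [F h]] := coarse_collect (hf m); exists (t, F).
  pose T := flatten [seq (tF m).1 | m <- s].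
  pose F u := (tF (dotv u v)).2 u.
  have fE m : f m = \sum_(u <- (tF m).1) F u.
    have [_ h _ _ ->] := htF m; rewrite !big_seq.
    by apply: eq_bigr => u /h hu; rewrite /F hu.
  have uT : uniq T.
    rewrite /T; elim: (s) us => //= m s' IH /andP[ms us'].
    rewrite cat_uniq IH // andbT; have [-> hm _ _ _] /= := htF m.
    apply/hasPn => u /flatten_mapP[m' hm' hu]; apply/negP => /hm eu.
    have [_ h _ _ _] := htF m'; move: ms; rewrite -eu (h u hu) hm' //.
  have HF u : H u (F u) by have [_ _ h _ _] := htF (dotv u v); apply: h.
  have sT : \sum_(u <- T) F u = 0.
    by rewrite /T big_flatten big_map -[RHS]sf0; apply: eq_bigr => m _.
  move=> m ms; rewrite fE big_seq big1 // => u hu.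
  by apply: (grading_direct HP uT HF sT); apply/flatten_mapP; exists m.
Qed.

End GradingLemmas.

(* M^[v] *)
Definition coarsen (M : gmodule K a) (v : 'rV[int]_r) : gmodule K (degv v) :=
  GModule (coarse_grading M v).

Definition semigroupQ : set 'rV[int]_r :=
  [set u | exists c : 'I_n -> nat, u = \sum_(i < n) a i *+ c i].

Definition positively_multigraded : Prop :=
  (forall i, a i != 0) /\
  (forall u, semigroupQ u -> semigroupQ (- u) -> u = 0).

Definition positive_coarsening (v : 'rV[int]_r) : Prop :=
  forall i, 0 < degv v i.

Definition cv (v : 'rV[int]_r) : int := \big[lcmz/1]_(i < n) degv v i.

Definition sv (v : 'rV[int]_r) : int :=
  Num.max (n%:Z * cv v - \sum_(i < n) degv v i) (cv v).

Definition regv (M : gmodule K a) (v : 'rV[int]_r) : set int :=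
  [set p | forall i k : nat, local_cohomology_eq0 (coarsen M v) i
                               (p + (1 - i%:Z) * cv v + k%:Z * cv v)].

(* The infimum is taken in the extended integers: it is -oo if the set is not
   bounded below and +oo if the set is empty. *)
Definition reg_num (M : gmodule K a) (v : 'rV[int]_r) : \bar int :=
  infimum +oo%E [set p%:E | p in
    [set p | regv M v p /\ forall q, p <= q -> regv M v q]].

Definition shifted_semigroups (k : nat) (b : 'I_k -> 'rV[int]_r) :
    set 'rV[int]_r :=
  [set u | exists (j : 'I_k) (q : 'rV[int]_r), semigroupQ q /\ u = b j + q].

Definition Dset (M : gmodule K a) (k : nat) (b : 'I_k -> 'rV[int]_r)
    (i : nat) (v : 'rV[int]_r) : set 'rV[int]_r :=
  [set u | shifted_semigroups b u /\
     ((dotv u v)%:E <= reg_num M v + (i%:Z * sv v + cv v - 1)%:E)%E].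

End Coarsening.

(* Main.v *)
Require Import Defs.
From HB Require Import structures.
From mathcomp Require Import all_boot all_order all_algebra.
From mathcomp Require Import mpoly.
From mathcomp Require Import constructive_ereal boolp classical_sets.
Import Order.TTheory GRing.Theory Num.Theory.
Local Open Scope classical_set_scope.
Local Open Scope ring_scope.

(** Replacing [v] by [d v] multiplies every coarse degree by [d], so [M^[dv]] is
    [M^[v]] with its degree-[m] part moved to degree [d m] and nothing placed in
    the degrees that [d] does not divide.  The local cohomology follows the same
    rule: in degree [d m] it vanishes for [M^[dv]] exactly when it vanishes for
    [M^[v]] in degree [m], and in the other degrees it is always zero.

    The regularity then transforms by pure arithmetic, because [c_v] and [s_v]
    are multiplied by [d] as well.  A tail [t, t + 1, ...] lies in [reg_v]
    exactly when the tail starting at [d t] lies in [reg_dv]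
    ([regv_tail_scale]).  On the other hand, since the set of starting points of such tails is upward
    closed, the inequality defining [D_(i,v)] says precisely that
    [a.v - i s_v - c_v] is not one of them ([le_infimum_tail]).  This last
    quantity is multiplied by [d] when [v] is, so both sides agree; the argument
    covers the values [-oo] and [+oo] of the regularity number too.

    The work is in the statement on local cohomology, which is proved for an
    arbitrary injective additive map [phi] of degree groups in place of the
    multiplication by [d].  Vanishing of local cohomology is a statement about all injective
    resolutions, so both resolutions over the small grading and resolutions over
    the large one have to be transported.  Regrading along [phi] and restricting
    to the degrees in the image of [phi] are exact functors, and each of them
    preserves injective objects ([regrade_injective], [restrict_injective]):
    over the large grading a module is the direct sum of its part in the image
    degrees and its part in the others, as the variables have image degrees.
    This gives [regrade_local_cohomology].

    For a degree off the image, the part of a resolution of the regraded module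
    in such degrees is an exact sequence of injectives resolving zero, hence it
    is split, and a splitting is linear, so it preserves torsion and exhibits
    each torsion cocycle as a torsion coboundary.  The splitting is built degree
    by degree in [graded_injective_lift] and [cocycle_retraction]. *)

(** * Linear maps and submodules *)

Section Linear.
Set Implicit Arguments.
Unset Strict Implicit.
Variables (R : pzRingType) (U V : lmodType R).

Definition mk_linear (f : U -> V) (lf : linear f) : {linear U -> V} :=
  HB.pack f (GRing.isLinear.Build R U V *:%R f lf).

Lemma mk_linearE f (lf : linear f) x : mk_linear lf x = f x.
Proof. by []. Qed.

End Linear.

Section Submodule.
Set Implicit Arguments.
Unset Strict Implicit.
Variables (R : pzRingType) (M : lmodType R).

(** The closure proof is an argument of the type, so that predicates defined
    locally in a proof also give modules. *)
Record submodule (P : {pred M}) (hP : submod_closed P) :=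
  Submodule { submodule_val :> M; submodule_valP : submodule_val \in P }.

Variables (P : {pred M}) (hP : submod_closed P).

HB.instance Definition _ := [isSub for @submodule_val P hP].
HB.instance Definition _ := [Choice of submodule hP by <:].
HB.instance Definition _ := GRing.SubChoice_isSubLmodule.Build R M P
  (submodule hP) (GRing.submod_closed_semi hP).

Lemma submodule_val_inj : injective (@submodule_val P hP).
Proof. exact: val_inj. Qed.

Lemma submodule_val_linear : linear (@submodule_val P hP).
Proof. by move=> c x y; exact: (linearP (val : submodule hP -> M)). Qed.

Definition incl : {linear submodule hP -> M} := mk_linear submodule_val_linear.

Lemma corestrict_linear (N : lmodType R) (f : {linear N -> M})
  (hf : forall x, f x \in P) : linear (fun x => Submodule hP (hf x)).
Proof.
move=> c x y; apply: submodule_val_inj.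
by rewrite submodule_val_linear /= linearP.
Qed.

Definition corestrict (N : lmodType R) (f : {linear N -> M})
  (hf : forall x, f x \in P) : {linear N -> submodule hP} :=
  mk_linear (corestrict_linear hf).

End Submodule.

(** * Elements with prescribed degrees *)

Section Parts.
Set Implicit Arguments.
Unset Strict Implicit.
Variables (K : fieldType) (n : nat) (G : zmodType) (w : 'I_n -> G).
Local Notation S := {mpoly K[n]}.

Lemma homog_monomial (m : 'X_{1..n}) (c : K) :
  homog_poly w (monomial_degree w m) (c *: 'X_[m] : S).
Proof.
move=> m' hm'; have : m' \in msupp ('X_[m] : S) by apply: msuppZ_le hm'.
by rewrite msuppX inE => /eqP->.
Qed.

Definition supported (M : gmodule K w) (D : set G) : set M :=
  [set x | exists2 xs : seq M,
    (forall y, y \in xs -> exists2 g, D g & component M g y)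
    & x = \sum_(y <- xs) y].
Arguments supported M D : clear implicits.

(** Stability under the degrees of the monomials is what makes the elements
    supported in [D] a submodule. *)
Definition degree_stable (D : set G) : Prop :=
  forall m g, D g -> D (monomial_degree w m + g).

Section Module.
Variable M : gmodule K w.
Local Notation H := (component M).
Let HP : is_grading w H := component_grading M.

Lemma component0 g : H g 0. Proof. exact: (grading0 HP). Qed.

Lemma component_opp g x : H g x -> H g (- x).
Proof.
by move=> hx; rewrite -sub0r; apply: (gradingB HP) => //;
  apply: component0. Qed.

Lemma component_add g x y : H g x -> H g y -> H g (x + y).
Proof.
by move=> hx hy; rewrite -[y]opprK; apply: (gradingB HP) => //;
  apply: component_opp.
Qed.

Lemma supported_component D g x : D g -> H g x -> supported M D x.
Proof.
by move=> Dg hx; exists [:: x]; rewrite ?big_seq1 // => y;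
  rewrite inE => /eqP->; exists g.
Qed.

Lemma supported_ind D (P : M -> Prop) :
  P 0 -> (forall x y, P x -> P y -> P (x + y)) ->
  (forall g x, D g -> H g x -> P x) -> forall x, supported M D x -> P x.
Proof.
move=> P0 PD PH x [xs hxs ->]; rewrite big_seq; elim/big_ind: _ => // y.
by case/hxs => g; apply: PH.
Qed.

Lemma supported0 D : supported M D 0.
Proof. by exists [::]; rewrite ?big_nil. Qed.

Lemma supportedD D x y : supported M D x -> supported M D y ->
  supported M D (x + y).
Proof.
move=> [xs hxs ->] [ys hys ->]; exists (xs ++ ys); last by rewrite big_cat.
by move=> z; rewrite mem_cat => /orP[/hxs|/hys].
Qed.

Lemma supportedZ D p x : degree_stable D -> supported M D x ->
  supported M D (p *: x).
Proof.
move=> stD; elim/supported_ind: x / => [|x y hx hy|g x Dg hx].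
- by rewrite scaler0; apply: supported0.
- by rewrite scalerDr; apply: supportedD.
rewrite [p]mpolyE scaler_suml; elim/big_ind: _ => //.
- exact: supported0.
- exact: supportedD.
move=> m _; apply: supported_component (stD m g Dg) _.
by apply: (gradingM HP) => //; apply: homog_monomial.
Qed.

Lemma supportedN D x : degree_stable D -> supported M D x ->
  supported M D (- x).
Proof. by move=> stD hx; rewrite -scaleN1r; apply: supportedZ. Qed.

Lemma supportedB D x y : degree_stable D ->
  supported M D x -> supported M D y -> supported M D (x - y).
Proof. by move=> stD hx hy; apply: supportedD => //; apply: supportedN. Qed.

Lemma supported_submod D : degree_stable D ->
  submod_closed [pred x | `[< supported M D x >]].
Proof.
move=> stD; split=> [|c x y /asboolP hx /asboolP hy]; apply: asboolT.
  exact: supported0.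
by apply: supportedD => //; apply: supportedZ.
Qed.

(* collecting *)
Lemma supported_collect D x : supported M D x ->
  exists (t : seq G) (F : G -> M),
  [/\ uniq t, forall g, g \in t -> D g, forall g, H g (F g) &
      x = \sum_(g <- t) F g].
Proof.
case=> xs hxs ->.
have /choice[deg hdeg] y : exists g, y \in xs -> D g /\ H g y.
  have [/hxs[g Dg yg]|_] := boolP (y \in xs); first by exists g.
  by exists 0.
exists (undup (map deg xs)), (fun g => \sum_(y <- xs | deg y == g) y); split.
- exact: undup_uniq.
- by move=> g; rewrite mem_undup => /mapP[y /hdeg[Dy _] ->].
- move=> g; rewrite big_seq_cond; elim/big_ind: _ => [|y z|y].
  + exact: component0.
  + exact: component_add.
  + by case/andP=> /hdeg[_ yg] /eqP <-.
rewrite (exchange_big_dep xpredT) //= big_seq [RHS]big_seq.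
apply: eq_bigr => y yxs; under eq_bigl do rewrite eq_sym.
rewrite -big_filter filter_pred1_uniq ?undup_uniq ?big_seq1 //.
by rewrite mem_undup map_f.
Qed.

(** Collecting terms of equal degree on both sides turns two expressions of [x]
    into one relation between components of distinct degrees. *)
Lemma supported_disjoint D x : supported M D x -> supported M (~` D) x -> x = 0.
Proof.
move=> /supported_collect[t1 [F1 [ut1 tD1 FH1 e1]]].
move=> /supported_collect[t2 [F2 [ut2 tD2 FH2 e2]]].
pose F g := if `[< D g >] then F1 g else - F2 g.
have FE1 g : g \in t1 -> F g = F1 g by move=> /tD1 Dg; rewrite /F asboolT.
have FE2 g : g \in t2 -> F g = - F2 g by move=> /tD2 Dg; rewrite /F asboolF.
rewrite e1 big_seq big1 // => g gt1; rewrite -FE1 //.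
apply: (@grading_direct _ _ _ _ _ _ HP (t1 ++ t2) F);
  last by rewrite mem_cat gt1.
- rewrite cat_uniq ut1 ut2 andbT; apply/hasPn => h ht2; apply/negP => ht1.
  exact: tD2 ht2 (tD1 _ ht1).
- by move=> h; rewrite /F; case: asboolP => _ //; apply: component_opp.
rewrite big_cat /= (eq_big_seq _ FE1) -e1 (eq_big_seq _ FE2) sumrN -e2.
exact: subrr.
Qed.

Lemma supported_decomposition D x :
  exists y z, [/\ supported M D y, supported M (~` D) z & x = y + z].
Proof.
have [xs hxs ->] := grading_sum HP x; rewrite big_seq; elim/big_ind: _.
- by exists 0, 0; split; rewrite ?addr0 //; apply: supported0.
- move=> _ _ [y [z [hy hz ->]]] [y' [z' [hy' hz' ->]]].
  by exists (y + y'), (z + z'); split; rewrite 1?addrACA //; apply: supportedD.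
move=> y /hxs[g hy]; have [Dg|Dg] := pselect (D g).
  exists y, 0; split; rewrite ?addr0 //; last exact: supported0.
  exact: supported_component Dg hy.
exists 0, y; split; rewrite ?add0r //; first exact: supported0.
exact: supported_component Dg hy.
Qed.

(** A decomposition into supported parts is unique, so choosing one for each
    element is automatically linear. *)
Lemma exists_projection D : degree_stable D -> degree_stable (~` D) ->
  exists pi : {linear M -> M},
    forall x, supported M D (pi x) /\ supported M (~` D) (x - pi x).
Proof.
move=> stD stC.
have /choice[f hf] x : exists y, supported M D y /\ supported M (~` D) (x - y).
  have [y [z [hy hz ->]]] := supported_decomposition D x.
  by exists y; rewrite addrAC subrr add0r.
have lf : linear f.
  move=> c x y; apply/eqP; rewrite -subr_eq0; apply/eqP.
  have [[[h1 h1'] [h2 h2']] [h3 h3']] := (hf (c *: x + y), hf x, hf y).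
  apply: (@supported_disjoint D).
    by apply: supportedB => //; apply: supportedD => //; apply: supportedZ.
  have -> : f (c *: x + y) - (c *: f x + f y) =
     (c *: (x - f x) + (y - f y)) - (c *: x + y - f (c *: x + y)).
    by rewrite scalerBr addrACA -opprD opprB [RHS]addrC addrA subrK.
  by apply: supportedB => //; apply: supportedD => //; apply: supportedZ.
by exists (mk_linear lf).
Qed.

Section Projection.
Variables (D : set G) (stD : degree_stable D) (stC : degree_stable (~` D)).
Variables (pi : {linear M -> M}).
Hypothesis hpi : forall x, supported M D (pi x) /\
  supported M (~` D) (x - pi x).

Lemma projection_id x : supported M D x -> pi x = x.
Proof.
have [h1 h2] := hpi x => hx; apply/esym/eqP; rewrite -subr_eq0; apply/eqP.
by apply: supported_disjoint h2; apply: supportedB.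
Qed.

Lemma projection_eq0 x : supported M (~` D) x -> pi x = 0.
Proof.
have [h1 h2] := hpi x => hx; apply: supported_disjoint h1 _.
rewrite -[pi x](subKr x); exact: supportedB.
Qed.
End Projection.

End Module.

Lemma graded_hom_supported (A B : gmodule K w) (f : {linear A -> B}) D x :
  graded_hom f -> supported A D x -> supported B D (f x).
Proof.
move=> hf; elim/supported_ind: x / => [|x y hx hy|g x Dg hx].
- by rewrite linear0; apply: supported0.
- by rewrite linearD; apply: supportedD.
- by apply: supported_component Dg _; apply: hf.
Qed.

End Parts.
Arguments supported {K n G w} M D _.

(** * Graded submodules *)

Section SubGraded.
Set Implicit Arguments.
Unset Strict Implicit.
Variables (K : fieldType) (n : nat) (G G' : zmodType) (phi : G -> G').
Hypotheses (phiD : {morph phi : x y / x + y}) (phiI : injective phi).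
Variables (w : 'I_n -> G) (w' : 'I_n -> G').
Hypothesis hw : forall i, w' i = phi (w i).

Lemma morph_monomial_degree m :
  monomial_degree w' m = phi (monomial_degree w m).
Proof.
have phi0 : phi 0 = 0 by apply: (addrI (phi 0)); rewrite -phiD !addr0.
rewrite /monomial_degree (big_morph phi phiD phi0); apply: eq_bigr => i _.
by rewrite hw; elim: (m i) => [|k IH]; rewrite ?mulr0n ?phi0 // !mulrS phiD IH.
Qed.

Lemma morph_homog_poly g (p : {mpoly K[n]}) :
  homog_poly w g p -> homog_poly w' (phi g) p.
Proof. by move=> hp m /hp <-; apply: morph_monomial_degree. Qed.

(* Taking [phi := id] gives the graded submodules in the usual sense; for other
   [phi] the submodule is graded by the smaller group at the same time. *)
Variables (M : gmodule K w') (P : {pred M}) (hP : submod_closed P).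
Hypothesis homP : forall x, x \in P -> exists2 xs : seq M,
  (forall y, y \in xs -> y \in P /\ exists g, component M (phi g) y)
  & x = \sum_(y <- xs) y.

Definition sub_component (g : G) : set (submodule hP) :=
  [set x | component M (phi g) (incl hP x)].

Lemma sub_componentE g x :
  sub_component g x = component M (phi g) (incl hP x).
Proof. by []. Qed.

Lemma sub_grading : is_grading w sub_component.
Proof.
have HP := component_grading M; split.
- by move=> g; rewrite sub_componentE linear0; apply: component0.
- by move=> g x y hx hy; rewrite sub_componentE linearB; apply: (gradingB HP).
- move=> g h p x hp hx; rewrite sub_componentE linearZ phiD.
  by apply: (gradingM HP) => //; apply: morph_homog_poly.
- move=> x; have [xs hxs ex] := homP (submodule_valP x).
  suff [ys hys eys] : exists2 ys : seq (submodule hP),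
      (forall y, y \in ys -> exists g, sub_component g y)
      & incl hP (\sum_(y <- ys) y) = \sum_(y <- xs) y.
    by exists ys => //; apply: (@submodule_val_inj _ _ _ hP); rewrite ex -eys.
  elim: xs hxs {ex} => [_|y xs IH hxs].
    by exists [::]; rewrite ?big_nil ?linear0.
  have [|ys hys eys] := IH; first by move=> z zxs; apply: hxs;
    rewrite inE zxs orbT.
  have [yP [g yg]] := hxs y (mem_head _ _).
  exists (Submodule hP yP :: ys); last by rewrite !big_cons linearD eys.
  by move=> z; rewrite inE => /orP[/eqP->|/hys//]; exists g.
- move=> s f us hf sf0 g gs.
  (* The family [f] transported along [phi], with value 0 off the image. *)
  pose F h := \sum_(g <- s | phi g == h) incl hP (f g).
  have FE g1 : g1 \in s -> F (phi g1) = incl hP (f g1).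
    move=> g1s; rewrite /F -big_filter.
    rewrite (eq_filter (a2 := pred1 g1)); last by move=> g2; exact: inj_eq.
    by rewrite filter_pred1_uniq // big_seq1.
  apply: (@submodule_val_inj _ _ _ hP); rewrite -[LHS](FE g gs).
  rewrite -[RHS]/(incl hP 0) linear0.
  apply: (grading_direct HP (s := map phi s)).
  + by rewrite map_inj_uniq.
  + move=> h; rewrite /F; elim/big_ind: _ => [|x y|g1 /eqP <-].
    * exact: component0.
    * exact: component_add.
    * exact: hf.
  + by rewrite big_map (eq_big_seq _ FE) -linear_sum sf0 linear0.
  + exact: map_f.
Qed.

Definition sub_gmodule : gmodule K w := GModule sub_grading.

End SubGraded.

(** * Vanishing in degrees where the module has no elements *)

Section Vanishing.
Set Implicit Arguments.
Unset Strict Implicit.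
Variables (K : fieldType) (n : nat) (G : zmodType) (w : 'I_n -> G).

Lemma torsion_linear (A B : gmodule K w) (f : {linear A -> B}) x :
  torsion x -> torsion (f x).
Proof. by move=> [t ht]; exists t => p hp; rewrite -linearZ ht ?linear0. Qed.

Lemma supported1 (M : gmodule K w) g x : supported M [set g] x ->
  component M g x.
Proof.
elim/supported_ind: x / => [|x y|h x -> //];
  [exact: component0|exact: component_add].
Qed.

Variables (D : set G) (stD : degree_stable w D).

(** The inductive step of the contraction of an exact sequence of injectives: as
    [h] fixes the cocycles, [1 - h] kills them, hence it factors through the
    image of [d], and injectivity extends the factor [s] to the target.  All of
    this takes place inside the elements supported in [D]. *)
Lemma graded_injective_lift (E F : gmodule K w) (d : {linear E -> F})
    (h : {linear E -> E}) :
  graded_injective E -> graded_hom d -> graded_hom h ->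
  (forall z, supported E D z -> d z = 0 -> h z = z) ->
  exists2 s : {linear F -> E}, graded_hom s &
    forall x, supported E D x -> s (d x) = x - h x.
Proof.
move=> injE hd hh hfix.
pose P : {pred F} := [pred z | `[< exists2 x, supported E D x & z = d x >]].
have hP : submod_closed P.
  split=> [|c y z /asboolP[x hx ->] /asboolP[x' hx' ->]]; apply: asboolT.
    by exists 0; rewrite ?linear0 //; apply: supported0.
  exists (c *: x + x'); rewrite ?linearP //.
  by apply: supportedD => //; apply: supportedZ.
have homP x : x \in P -> exists2 xs : seq F,
    (forall y, y \in xs -> y \in P /\ exists g, component F (id g) y)
    & x = \sum_(y <- xs) y.
  move=> /asboolP[_ [xs hxs ->] ->]; exists (map d xs); last first.
    by rewrite big_map linear_sum.
  move=> _ /mapP[y /hxs[g Dg yg] ->]; split; last by exists g; apply: hd.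
  by apply: asboolT; exists y => //; apply: supported_component yg.
pose A := @sub_gmodule K n G G id (fun _ _ => erefl) (@inj_id G) w w
  (fun=> erefl) F P hP homP.
have liftA (z : A) : exists x, supported E D x /\ incl hP z = d x.
  by have /asboolP[x] := submodule_valP z; exists x.
have eq_lift x x' : supported E D x -> supported E D x' -> d x = d x' ->
    x - h x = x' - h x'.
  move=> hx hx' e; apply/eqP; rewrite -subr_eq0 opprD addrACA -opprD -linearB.
  rewrite hfix ?subrr //; first exact: supportedB.
  by rewrite linearB e subrr.
have [f hf] := choice liftA.
have lin_f : linear (fun z : A => f z - h (f z)).
  move=> c y z; rewrite scalerBr addrACA -opprD -linearP.
  have [[hy ey] [hz ez] [hyz eyz]] := And3 (hf y) (hf z) (hf (c *: y + z)).
  apply: eq_lift => //; first by apply: supportedD => //; apply: supportedZ.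
  by rewrite -eyz !linearP ey ez.
have gr_f : graded_hom (mk_linear lin_f : {linear A -> E}).
  move=> g z zg; rewrite mk_linearE; have [hx ex] := hf z.
  have [Dg|nDg] := pselect (D g); last first.
    have dx0 : d (f z) = 0.
      apply: (@supported_disjoint _ _ _ _ _ D).
        exact: graded_hom_supported hx.
      by rewrite -ex; apply: (@supported_component _ _ _ _ _ _ g).
    by rewrite hfix // subrr; apply: component0.
  (* The chosen preimage [f z] need not be homogeneous.  Its component [y] of
     degree [g] is another preimage, and the rest is a cocycle fixed by [h]. *)
  have [y [y' [hy hy' e]]] := supported_decomposition [set g] (f z).
  have yg := supported1 hy.
  have Dy : supported E D y by apply: supported_component yg.
  have Dy' : supported E D y'.
    by rewrite -[y'](addKr y) -e addrC; apply: supportedB.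
  have dy' : d y' = 0.
    apply: (@supported_disjoint _ _ _ _ _ [set g]); last first.
      exact: graded_hom_supported hy'.
    rewrite -[y'](addKr y) -e addrC linearB -ex.
    apply: (@supported_component _ _ _ _ _ _ g) => //.
    by apply: (gradingB (component_grading F)) => //; apply: hd.
  have -> : f z - h (f z) = y - h y.
    by rewrite e linearD opprD addrACA (hfix y') // subrr addr0.
  by apply: (gradingB (component_grading E)) => //; apply: hh.
have [s hs es] := injE A F (incl hP) (mk_linear lin_f) (fun _ _ => id)
  (@submodule_val_inj _ _ _ hP) gr_f.
exists s => // x hx.
have xP : d x \in P by apply: asboolT; exists x.
rewrite -[d x]/(incl hP (Submodule hP xP)) es mk_linearE.
by have [hf1 ef] := hf (Submodule hP xP); apply: eq_lift.
Qed.

Variables (M : gmodule K w) (E : injective_resolution M).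
Hypothesis M0 : forall x, supported M D x -> x = 0.

(** Each [h] beyond the first is [d s] for the lift [s] of the previous one;
    since [s] is linear and graded, [h] sends torsion elements to torsion
    coboundaries.  In position 0 the cocycles supported in [D] come from
    elements of [M] supported in [D], so they vanish and [h := 0] works. *)
Lemma cocycle_retraction i : exists h : {linear E i -> E i},
  [/\ graded_hom h, forall x, res_diff E i (h x) = 0,
      forall z, supported (E i) D z -> res_diff E i z = 0 -> h z = z &
      forall g x, torsion x -> component (E i) g x ->
        torsion_coboundaries (E := E) (i := i) g (h x)].
Proof.
elim: i => [|i [h [gh dh fh _]]].
  have l0 : linear (fun _ : E 0 => 0 : E 0) by move=> c x y;
    rewrite scaler0 addr0.
  exists (mk_linear l0); split=> //=.
  - by move=> g x _; apply: component0.
  - by move=> x; apply: linear0.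
  move=> z hz /res_exact0[y ey].
  have [y0 [y1 [/M0 -> hy1 e]]] := supported_decomposition D y.
  apply/esym/(supported_disjoint hz).
  rewrite ey e add0r; apply: graded_hom_supported hy1; exact: res_aug_graded.
have [s gs es] := graded_injective_lift (@res_injective _ _ _ _ _ E i)
  (@res_diff_graded _ _ _ _ _ E i) gh fh.
exists (res_diff E i \o s : {linear _ -> _}); split=> /=.
- by move=> g x /gs; apply: res_diff_graded.
- by move=> x; apply/res_exactS; exists (s x).
- move=> z hz /res_exactS[x ex].
  have [x0 [x1 [hx0 hx1 e]]] := supported_decomposition D x.
  have dx1 : res_diff E i x1 = 0.
    apply: (@supported_disjoint _ _ _ _ _ D); last first.
      by apply: graded_hom_supported hx1; apply: res_diff_graded.
    rewrite -[x1](addKr x0) -e addrC linearB -ex; apply: supportedB => //.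
    by apply: graded_hom_supported hx0; apply: res_diff_graded.
  by rewrite ex e linearD dx1 addr0 es // linearB dh subr0.
- by move=> g x tx xg; exists (s x); split=> //;
  [apply: torsion_linear|apply: gs].
Qed.

(** The retraction fixes a cocycle of degree in [D] and makes it a coboundary. *)
Lemma torsion_cocycle_boundary i g : D g ->
  torsion_cocycles (E := E) (i := i) g `<=`
  torsion_coboundaries (E := E) (i := i) g.
Proof.
move=> Dg x [tx xg dx]; have [h [_ _ fh bh]] := cocycle_retraction i.
rewrite -(fh x) //; first exact: bh.
exact: supported_component xg.
Qed.

End Vanishing.

(** * Change of grading along an injective map of degree groups *)

Section Regrading.
Set Implicit Arguments.
Unset Strict Implicit.
Variables (K : fieldType) (n : nat) (G G' : zmodType) (phi : G -> G').
Hypotheses (phiD : {morph phi : x y / x + y}) (phiI : injective phi).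
Variables (w : 'I_n -> G) (w' : 'I_n -> G').
Hypothesis hw : forall i, w' i = phi (w i).

Lemma homog_poly_morph g' (p : {mpoly K[n]}) : homog_poly w' g' p -> p != 0 ->
  exists2 g, phi g = g' & homog_poly w g p.
Proof.
move=> hp p0; have hl := mlead_supp p0.
exists (monomial_degree w (mlead p));
  first by rewrite -(morph_monomial_degree phiD hw) hp.
by move=> m mp; apply: phiI; rewrite -!(morph_monomial_degree phiD hw) !hp.
Qed.

(** The disjunct [x = 0] puts the zero submodule in the degrees off the image. *)
Definition regrade_component (M : gmodule K w) (g' : G') : set M :=
  [set x | x = 0 \/ exists2 g, phi g = g' & component M g x].
Arguments regrade_component : clear implicits.

Lemma regrade_componentP (M : gmodule K w) g x :
  regrade_component M (phi g) x <-> component M g x.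
Proof.
split=> [[->|[h /phiI <-]] //|hx]; first exact: component0.
by right; exists g.
Qed.

Lemma regrade_grading (M : gmodule K w) : is_grading w' (regrade_component M).
Proof.
have HP := component_grading M; split.
- by move=> g; left.
- move=> g' x y [->|[g <- hx]] [->|[h e hy]]; rewrite ?subr0 ?sub0r.
  + by left.
  + by right; exists h => //; apply: component_opp.
  + by right; exists g.
  by apply/regrade_componentP; apply: (gradingB HP); rewrite // -(phiI e).
- move=> g' h' p x hp [->|[h <- hx]]; first by left; rewrite scaler0.
  have [->|p0] := eqVneq p 0; first by left; rewrite scale0r.
  have [g <- hp'] := homog_poly_morph hp p0.
  by right; exists (g + h); rewrite ?phiD //; apply: (gradingM HP).
- move=> x; have [xs hxs ->] := grading_sum HP x; exists xs => // y /hxs[g hy].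
  by exists (phi g); apply/regrade_componentP.
move=> s f us hf sf0 g' g's.
have [-> //|[g eg _]] := hf g'.
pose D := [set phi h | h in [set: G]].
(* The nonzero members of the family sit in image degrees, so that pulling the
   family back along [phi] loses nothing. *)
have [psi psiK] : exists psi, cancel phi psi.
  have /choice[psi hpsi] g1 : exists h, D g1 -> phi h = g1.
    have [[h _ <-]|nD] := pselect (D g1); first by exists h.
    by exists 0.
  by exists psi => h; apply: phiI; apply: hpsi; exists h.
pose t := [seq psi h | h <- s & `[< D h >]].
have DK h : D h -> phi (psi h) = h by case=> h1 _ <-; rewrite psiK.
have ut : uniq t.
  rewrite map_inj_in_uniq ?filter_uniq // => x y.
  rewrite !mem_filter => /andP[/asboolP Dx _] /andP[/asboolP Dy _] e.
  by rewrite -(DK x) // e DK.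
rewrite -eg; apply: (@grading_direct _ _ _ _ _ _ HP t (f \o phi)) => //=.
- by move=> h; apply/regrade_componentP.
- rewrite /t big_map -[RHS]sf0 big_filter big_mkcond; apply: eq_bigr => h _ /=.
  case: asboolP => Dh; first by rewrite DK.
  by have [->//|[h1 e _]] := hf h; case: Dh; exists h1.
- apply/mapP; exists g'; rewrite -?eg ?psiK // mem_filter eg g's andbT.
  by apply: asboolT; exists g.
Qed.

Definition regrade (M : gmodule K w) :
  gmodule K w' := GModule (regrade_grading M).

Definition image_degrees : set G' := [set phi h | h in [set: G]].

Lemma image_degrees_stable : degree_stable w' image_degrees.
Proof.
move=> m _ [h _ <-]; rewrite (morph_monomial_degree phiD hw) -phiD.
by exists (monomial_degree w m + h).
Qed.

(** Here it matters that [phi] is a map of groups: the image is closed under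
    differences. *)
Lemma image_degreesC_stable : degree_stable w' (~` image_degrees).
Proof.
move=> m g hg [h _]; rewrite (morph_monomial_degree phiD hw) => e; apply: hg.
exists (h - monomial_degree w m) => //.
by apply: (addrI (phi (monomial_degree w m))); rewrite -phiD addrC subrK.
Qed.

Lemma regrade_supported_off (M : gmodule K w) x :
  supported (regrade M) (~` image_degrees) x -> x = 0.
Proof.
elim/supported_ind: x / => [//|x y -> ->|g' x hg]; first exact: addr0.
by case=> // -[g e _]; case: hg; exists g.
Qed.

Local Notation on_image N := [pred x | `[< supported N image_degrees x >]].

Lemma on_image_generated (N : gmodule K w') x :
  x \in on_image N -> exists2 xs : seq N,
    (forall y, y \in xs -> y \in on_image N /\ exists g, component N (phi g) y)
    & x = \sum_(y <- xs) y.
Proof.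
move=> /asboolP[xs hxs ->]; exists xs => // y /hxs[_ [g _ <-] hy].
split; last by exists g.
by apply: asboolT; apply: supported_component hy; exists g.
Qed.

(** The functor right adjoint to [regrade]: it keeps the part of [N] in the
    image degrees. *)
Definition restrict (N : gmodule K w') : gmodule K w :=
  sub_gmodule phiD phiI hw (supported_submod N image_degrees_stable)
    (@on_image_generated N).

Definition restrict_incl (N : gmodule K w') : {linear restrict N -> N} :=
  incl (supported_submod N image_degrees_stable).

Lemma restrict_incl_inj N : injective (restrict_incl N).
Proof. exact: submodule_val_inj. Qed.

Lemma restrict_inclP N (x : restrict N) :
  supported N image_degrees (restrict_incl N x).
Proof. exact: (asboolW (submodule_valP x)). Qed.

Lemma restrict_component N g (x : restrict N) :
  component (restrict N) g x <-> component N (phi g) (restrict_incl N x).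
Proof. by []. Qed.

Lemma restrict_lift N x : supported N image_degrees x ->
  exists y, restrict_incl N y = x.
Proof. by move=> hx; exists (Submodule _ (asboolT hx)). Qed.

Definition to_restrict (A : lmodType {mpoly K[n]}) (N : gmodule K w')
    (f : {linear A -> N}) (hf : forall x, supported N image_degrees (f x)) :
    {linear A -> restrict N} :=
  corestrict (supported_submod N image_degrees_stable) (fun x => asboolT (hf
    x)).

Lemma to_restrictK (A : lmodType {mpoly K[n]}) (N : gmodule K w')
    (f : {linear A -> N}) (hf : forall x, supported N image_degrees (f x)) x :
  restrict_incl N (to_restrict hf x) = f x.
Proof. by []. Qed.

Lemma regrade_supported (M : gmodule K w) x :
  supported (regrade M) image_degrees x.
Proof.
have [y [z [hy /regrade_supported_off -> ->]]] :=
  supported_decomposition (M := regrade M) image_degrees x.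
by rewrite addr0.
Qed.

Lemma regrade_hom (A B : gmodule K w) (f : {linear A -> B}) :
  graded_hom f -> graded_hom (f : {linear regrade A -> regrade B}).
Proof.
move=> hf g' x [->|[g <- hx]]; first by left; apply: linear0.
by apply/regrade_componentP; apply: hf.
Qed.

Lemma regrade_hom_restrict (A : gmodule K w) (N : gmodule K w')
    (f : {linear A -> restrict N}) : graded_hom f ->
  graded_hom (restrict_incl N \o f : {linear regrade A -> N}).
Proof.
move=> hf g' x [->|[g <- hx]] /=; last by apply/restrict_component; apply: hf.
by rewrite !linear0; apply: component0.
Qed.

(** Given an extension problem over the large grading, restrict it to the image
    degrees, solve it there, and precompose with the projection: off the image
    the target is zero, so nothing is lost. *)
Lemma regrade_injective (E : gmodule K w) :
  graded_injective E -> graded_injective (regrade E).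
Proof.
move=> injE A B f h hf fI hh.
have [piA hA] := exists_projection A image_degrees_stable image_degreesC_stable.
have [piB hB] := exists_projection B image_degrees_stable image_degreesC_stable.
have hfA (x : restrict A) :
  supported B image_degrees ((f \o restrict_incl A) x).
  by apply: graded_hom_supported hf _; apply: restrict_inclP.
have f0I : injective (to_restrict hfA).
  move=> x y /(congr1 (restrict_incl B)); rewrite !to_restrictK.
  by move/fI; apply: restrict_incl_inj.
have f0h : graded_hom (to_restrict hfA).
  by move=> g x /restrict_component hx; apply/restrict_component; apply: hf.
have h0h : graded_hom (h \o restrict_incl A : {linear restrict A -> E}).
  by move=> g x /restrict_component hx; apply/regrade_componentP; apply: hh.
have [h' gh' eh'] := injE _ _ _ _ f0h f0I h0h.
pose pB := to_restrict (fun x => proj1 (hB x)).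
exists (h' \o pB : {linear B -> regrade E}).
  move=> g' x xg'; have [[g _ eg]|ng] := pselect (image_degrees g').
    rewrite -eg; apply/regrade_componentP; apply: gh'; apply/restrict_component.
    rewrite to_restrictK (projection_id image_degrees_stable hB) ?eg //.
    by apply: supported_component xg'; exists g.
  left; rewrite -[LHS]/(h' (pB x)); have -> : pB x = 0.
    apply: restrict_incl_inj; rewrite to_restrictK linear0.
    apply: (projection_eq0 image_degreesC_stable hB).
    exact: (@supported_component _ _ _ _ _ _ g').
  exact: linear0.
move=> x; rewrite -[LHS]/(h' (pB (f x))); have [xD xC] := hA x.
have [x0 ex0] := restrict_lift xD.
have -> : pB (f x) = to_restrict hfA x0.
  apply: restrict_incl_inj;
    rewrite !to_restrictK -[RHS]/(f (restrict_incl A x0)) ex0.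
  rewrite -{1}[x](subrK (piA x)) (linearD f) (linearD piB).
  rewrite (projection_eq0 image_degreesC_stable hB) ?add0r.
    rewrite (projection_id image_degrees_stable hB) //.
    exact: graded_hom_supported xD.
  exact: graded_hom_supported xC.
rewrite eh' -[LHS]/(h (restrict_incl A x0)) ex0 -[in RHS](subrK (piA x) x)
  linearD.
rewrite (regrade_supported_off (graded_hom_supported hh xC)).
exact/esym/add0r.
Qed.

(** A right adjoint of the exact functor [regrade] preserves injectives. *)
Lemma restrict_injective (E : gmodule K w') :
  graded_injective E -> graded_injective (restrict E).
Proof.
move=> injE A B f h hf fI hh.
have [h' gh' eh'] := injE _ _ _ _ (regrade_hom hf) fI (regrade_hom_restrict hh).
have hB x : supported E image_degrees (h' x).
  by apply: graded_hom_supported gh' _; apply: regrade_supported.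
exists (to_restrict hB : {linear B -> restrict E}).
  move=> g x hx; apply/restrict_component; rewrite to_restrictK; apply: gh'.
  exact/regrade_componentP.
by move=> x; apply: restrict_incl_inj; rewrite to_restrictK eh'.
Qed.

Section Resolutions.
Variable M : gmodule K w.

Definition regrade_resolution (E : injective_resolution M) :
  injective_resolution (regrade M) :=
  @InjectiveResolution _ _ _ _ (regrade M) (fun i => regrade (E i))
    (res_aug E) (res_diff E) 
    (fun i => regrade_injective (@res_injective _ _ _ _ _ E i))
    (regrade_hom (@res_aug_graded _ _ _ _ _ E))
    (fun i => regrade_hom (@res_diff_graded _ _ _ _ _ E i))
    (@res_aug_inj _ _ _ _ _ E) (@res_exact0 _ _ _ _ _ E)
    (@res_exactS _ _ _ _ _ E).

Variable E : injective_resolution (regrade M).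

Lemma restrict_aug_supported x : supported (E 0) image_degrees (res_aug E x).
Proof.
by apply: graded_hom_supported (@res_aug_graded _ _ _ _ _ E) _;
  apply: regrade_supported.
Qed.

Lemma restrict_diff_supported i (x : restrict (E i)) :
  supported (E i.+1) image_degrees ((res_diff E i \o restrict_incl (E i)) x).
Proof.
apply: graded_hom_supported (@res_diff_graded _ _ _ _ _ E i) _.
exact: restrict_inclP.
Qed.

Definition restrict_aug : {linear M -> restrict (E 0)} :=
  to_restrict restrict_aug_supported.

Definition restrict_diff i : {linear restrict (E i) -> restrict (E i.+1)} :=
  to_restrict (@restrict_diff_supported i).

Lemma restrict_aug_graded : graded_hom restrict_aug.
Proof.
move=> g x hx; apply/restrict_component; rewrite to_restrictK.
by apply: res_aug_graded; apply/regrade_componentP.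
Qed.

Lemma restrict_diff_graded i : graded_hom (restrict_diff i).
Proof. by move=> g x hx; apply/restrict_component; apply: res_diff_graded. Qed.

Lemma restrict_aug_inj : injective restrict_aug.
Proof.
by move=> x y /(congr1 (restrict_incl _)) /(@res_aug_inj _ _ _ _ _ E). Qed.

Lemma restrict_diff_eq0 i x :
  restrict_diff i x = 0 <-> res_diff E i (restrict_incl _ x) = 0.
Proof.
split=> [/(congr1 (restrict_incl _))|e]; first by rewrite to_restrictK linear0.
by apply: restrict_incl_inj; rewrite to_restrictK linear0.
Qed.

Lemma restrict_exact0 x :
  restrict_diff 0 x = 0 <-> exists y, x = restrict_aug y.
Proof.
rewrite restrict_diff_eq0 res_exact0; split=> -[y e]; exists y.
  by apply: restrict_incl_inj; rewrite to_restrictK.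
by rewrite e to_restrictK.
Qed.

(** A preimage under the differential can be replaced by its part in the image
    degrees, because the differential preserves the decomposition. *)
Lemma restrict_exactS i x :
  restrict_diff i.+1 x = 0 <-> exists y, x = restrict_diff i y.
Proof.
rewrite restrict_diff_eq0 res_exactS; split=> -[y e]; last first.
  by exists (restrict_incl _ y); rewrite e to_restrictK.
have [y0 [y1 [hy0 hy1 ey]]] := supported_decomposition image_degrees y.
have dy1 : res_diff E i y1 = 0.
  have h0 := graded_hom_supported (@res_diff_graded _ _ _ _ _ E i) hy0.
  apply: (@supported_disjoint _ _ _ _ _ image_degrees); last first.
    by apply: graded_hom_supported hy1; apply: res_diff_graded.
  rewrite -[y1](addKr y0) -ey addrC linearB -e; apply: supportedB => //.
    exact: image_degrees_stable.
  exact: restrict_inclP.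
have [z ez] := restrict_lift hy0.
exists z; apply: restrict_incl_inj; rewrite to_restrictK.
by rewrite -[RHS]/(res_diff E i (restrict_incl _ z)) ez e ey linearD dy1 addr0.
Qed.

Definition restrict_resolution : injective_resolution M :=
  @InjectiveResolution _ _ _ _ M (fun i => restrict (E i))
    restrict_aug restrict_diff
    (fun i => restrict_injective (@res_injective _ _ _ _ _ E i))
    restrict_aug_graded restrict_diff_graded restrict_aug_inj
    restrict_exact0 restrict_exactS.

Lemma restrict_torsion i (x : restrict (E i)) :
  torsion x <-> torsion (restrict_incl _ x).
Proof.
split=> -[t ht]; exists t => p hp; first by rewrite -linearZ ht ?linear0.
by apply: restrict_incl_inj; rewrite linearZ linear0; apply: ht.
Qed.

End Resolutions.

(** Regrading a resolution of [M], and restricting a resolution of [regrade M],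
    do not change the torsion cocycles and coboundaries in the degrees
    concerned. *)
Theorem regrade_local_cohomology (M : gmodule K w) i g :
  local_cohomology_eq0 (regrade M) i (phi g) <-> local_cohomology_eq0 M i g.
Proof.
split=> [h E x [tx /regrade_componentP xg dx]|h E x [tx xg dx]].
  have {tx xg dx} := h (regrade_resolution E) x (And3 tx xg dx).
  case: i x {h} => //= i x [y [ty /regrade_componentP yg ->]].
  by exists y.
have xD : supported (E i) image_degrees x by apply: supported_component xg;
  exists g.
have [x0 ex] := restrict_lift xD; rewrite -ex in tx xg dx *.
have {xD ex tx xg dx} := h (restrict_resolution E) x0 (And3
  (proj2 (restrict_torsion x0) tx) (proj2 (restrict_component _ _) xg)
  (proj2 (restrict_diff_eq0 x0) dx)).
case: i x x0 {h} => [|i] _ x0 /=; first by move=> ->;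
  exact: (linear0 (restrict_incl (E 0))).
move=> [y [ty yg ->]]; exists (restrict_incl _ y); split=> //.
exact/restrict_torsion.
Qed.

(** The regraded module has no elements in the degrees off the image. *)
Theorem regrade_local_cohomology_off (M : gmodule K w) i g' :
  ~ image_degrees g' -> local_cohomology_eq0 (regrade M) i g'.
Proof.
move=> hg' E; apply: (@torsion_cocycle_boundary _ _ _ _ (~` image_degrees)) =>
  //.
- exact: image_degreesC_stable.
- by move=> x; apply: regrade_supported_off.
Qed.

End Regrading.
Arguments regrade_component {K n G G'} phi {w} M g' _.

(** * Infima of sets of integers in the extended integers *)

Section IntegerInfimum.
Set Implicit Arguments.
Unset Strict Implicit.

Lemma int_min (A : set int) (m : int) : A !=set0 -> (forall p, A p -> m <= p) ->
  exists2 p, A p & forall q, A q -> p <= q.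
Proof.
move=> [p0 Ap0] mA.
have E q : A q -> q = m + (`|q - m|%N)%:Z.
  by move=> /mA mq; rewrite gez0_abs ?subr_ge0 // subrKC.
have ex : exists k : nat, `[< A (m + k%:Z) >].
  by exists `|p0 - m|%N; apply: asboolT; rewrite -E.
case: (ex_minnP ex) => k /asboolP Ak kmin; exists (m + k%:Z) => // q Aq.
by rewrite (E q Aq) lerD2l lez_nat; apply: kmin; apply: asboolT; rewrite -E.
Qed.

(** The infimum is defined by choice among the greatest lower bounds, so one has
    to be exhibited: the minimum of a set that is bounded below, or [-oo]. *)
Lemma le_infimum_int (A : set int) (z : int) :
  (z%:E <= infimum +oo%E [set p%:E | p in A])%E <-> forall p, A p -> z <= p.
Proof.
rewrite /infimum; case: eqP => [A0|/eqP/set0P[_ [p0 Ap0 _]]].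
  split=> [_ p Ap|_]; last exact: leey.
  have : [set p%:E | p in A] p%:E by exists p.
  by rewrite A0.
have infA : infimums [set p%:E | p in A]
    (xget +oo%E (infimums [set p%:E | p in A])).
  apply: xgetPex; have [[m hm]|unb] := pselect (exists m, forall p, A p ->
    m <= p).
    have [|p Ap pmin] := int_min _ hm; first by exists p0.
    exists p%:E; split=> [_ [q Aq <-]|y]; first by rewrite lee_fin; apply: pmin.
    by apply; exists p.
  exists -oo%E; split=> [y _|y hy]; first exact: leNye.
  case: y hy => [r||] hy //; last first.
    by have := hy p0%:E; rewrite leye_eq => /(_ (ex_intro2 _ _ p0 Ap0 erefl)).
  case: unb; exists r => p Ap.
  by have := hy p%:E; rewrite lee_fin; apply; exists p.
case: infA => lbA glbA; split=> [zA p Ap|hz].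
  by rewrite -lee_fin; apply: le_trans zA _; apply: lbA; exists p.
by apply: glbA => _ [p Ap <-]; rewrite lee_fin; apply: hz.
Qed.

(** The starting points of the tails contained in [P] form an upward closed set,
    and such a set lies in [z, z + 1, ...] exactly when it omits [z - 1]. *)
Lemma le_infimum_tail (P : set int) (x y : int) :
  (x%:E <= infimum +oo%E [set p%:E | p in
     [set p | P p /\ forall q, (p <= q)%R -> P q]] + y%:E)%E <->
  ~ (forall q, x - y - 1 <= q -> P q).
Proof.
set I := infimum _ _.
have -> : (x%:E <= I + y%:E)%E = ((x - y)%:E <= I)%E.
  case: I => [r||].
  - by rewrite -EFinD !lee_fin lerBlDr.
  - by rewrite addye // !leey.
  - by rewrite addNye.
rewrite le_infimum_int; split=> [h hP|h p [Pp hp]].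
  have /h : P (x - y - 1) /\ forall q, x - y - 1 <= q -> P q.
    by split=> //; apply: hP.
  by rewrite lerBrDr gerDl.
rewrite leNgt; apply/negP => pxy; apply: h => q hq; apply: hp.
by apply: le_trans hq; rewrite lerBrDr lezD1.
Qed.

End IntegerInfimum.

(** * Scaling the coarsening vector *)

Lemma absz_mulrn (x : int) (d : nat) : `|x *+ d|%N = (`|x|%N * d)%N.
Proof. by rewrite -mulr_natr abszM natz. Qed.

(** For an empty family both big operators are 1, so the family has to be
    nonempty; this is where the number of variables has to be positive. *)
Lemma big_lcmz_scale (s : seq int) (d : nat) : s != [::] ->
  \big[lcmz/1]_(x <- s) (x *+ d) = (\big[lcmz/1]_(x <- s) x) *+ d.
Proof.
have nE (m : nat) : m%:Z *+ d = (m * d)%N%:Z by rewrite -mulr_natr natz.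
case: s => // x s _; elim: s x => [|y s IH] x.
  by rewrite !big_seq1_id /lcmz !lcmn1 absz_mulrn nE.
rewrite big_cons IH [in RHS]big_cons; move: (\big[_/_]_(_ <- _) _) => z.
by rewrite /lcmz !absz_mulrn -muln_lcml nE.
Qed.

Lemma gmodule_eq (K : fieldType) (n : nat) (G : zmodType) (w : 'I_n -> G)
    (M : lmodType {mpoly K[n]}) (H1 H2 : G -> set M)
    (h1 : is_grading w H1) (h2 : is_grading w H2) :
  H1 = H2 -> GModule h1 = GModule h2.
Proof. by move=> e; case: _ / e h2 => h2; rewrite (Prop_irrelevance h1 h2). Qed.

Section Scaling.
Set Implicit Arguments.
Unset Strict Implicit.
Variables (K : fieldType) (n r : nat) (a : 'I_n -> 'rV[int]_r).
Variables (v : 'rV[int]_r) (d : nat).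
Hypothesis (hd : (0 < d)%N).

Lemma dotv_scale u : dotv u (v *+ d) = dotv u v *+ d.
Proof.
by rewrite /dotv -sumrMnl; apply: eq_bigr => j _; rewrite mulmxnE mulrnAr.
Qed.

Let phi (m : int) : int := m *+ d.

Lemma scale_morph : {morph phi : x y / x + y}.
Proof. by move=> x y; rewrite /phi mulrnDl. Qed.

Lemma scale_inj : injective phi.
Proof. exact: pmulrnI. Qed.

Lemma degv_scale i : degv a (v *+ d) i = phi (degv a v i).
Proof. exact: dotv_scale. Qed.

Lemma coarse_component_scale (M : gmodule K a) :
  coarse_component (M := M) (v *+ d) =
  regrade_component phi (coarsen M v).
Proof.
apply/funext => g'; apply/seteqP; split=> x.
  case=> [[|y xs] hxs ->]; first by left; rewrite big_nil.
  right; have [u eu _] := hxs y (mem_head _ _); exists (dotv u v).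
    by rewrite -eu dotv_scale.
  exists (y :: xs) => // z /hxs[u' eu' zu']; exists u' => //.
  by apply: scale_inj; rewrite /phi -!dotv_scale eu eu'.
case=> [->|[g <- [xs hxs ->]]]; first by exists [::]; rewrite ?big_nil.
by exists xs => // y /hxs[u eu yu]; exists u => //; rewrite dotv_scale eu.
Qed.

Lemma coarsen_scale (M : gmodule K a) :
  coarsen M (v *+ d) = regrade scale_morph scale_inj degv_scale (coarsen M v).
Proof.
exact: (gmodule_eq _ _ (coarse_component_scale M)).
Qed.

Lemma coarsen_scale_local_cohomology (M : gmodule K a) i g :
  local_cohomology_eq0 (coarsen M (v *+ d)) i (g *+ d) <->
  local_cohomology_eq0 (coarsen M v) i g.
Proof. by rewrite coarsen_scale; apply: regrade_local_cohomology. Qed.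

Lemma coarsen_scale_local_cohomology_off (M : gmodule K a) i g :
  (forall h, h *+ d <> g) -> local_cohomology_eq0 (coarsen M (v *+ d)) i g.
Proof.
move=> hg; rewrite coarsen_scale; apply: regrade_local_cohomology_off.
by case=> h _; apply: hg.
Qed.

Hypothesis hn : (0 < n)%N.

Lemma cv_scale : cv a (v *+ d) = cv a v *+ d.
Proof.
rewrite /cv (eq_bigr _ (fun i _ => degv_scale i)).
rewrite -(big_map (degv a v) xpredT phi) big_lcmz_scale ?big_map //.
by rewrite -size_eq0 size_map -[index_enum _]enumT size_enum_ord -lt0n.
Qed.

Lemma sv_scale : sv a (v *+ d) = sv a v *+ d.
Proof.
rewrite /sv cv_scale (eq_bigr _ (fun i _ => degv_scale i)) /phi.
rewrite sumrMnl mulrnAr -mulrnBl.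
by rewrite /Num.max ltrMn2r hd /=; case: ifP.
Qed.

Lemma regv_scale (M : gmodule K a) p : regv M (v *+ d) (p *+ d) <-> regv M v p.
Proof.
have E (i k : nat) : p *+ d + (1 - i%:Z) * cv a (v *+ d) + k%:Z * cv a (v *+ d)
  =
    (p + (1 - i%:Z) * cv a v + k%:Z * cv a v) *+ d.
  by rewrite cv_scale !mulrnAr -!mulrnDl.
by split=> h i k; have := h i k; rewrite E coarsen_scale_local_cohomology.
Qed.

(** The step [c_dv] is a multiple of [d], so a progression that starts off the
    multiples of [d] stays off them. *)
Lemma regv_scale_off (M : gmodule K a) p :
  (forall h, h *+ d <> p) -> regv M (v *+ d) p.
Proof.
move=> hp i k; apply: coarsen_scale_local_cohomology_off => h.
rewrite cv_scale !mulrnAr -addrA -mulrnDl => e.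
apply: (hp (h - ((1 - i%:Z) * cv a v + k%:Z * cv a v))).
by rewrite mulrnBl e addrK.
Qed.

Lemma regv_tail_scale (M : gmodule K a) t :
  (forall q, t *+ d <= q -> regv M (v *+ d) q) <->
  (forall q, t <= q -> regv M v q).
Proof.
split=> h q tq; first by apply/regv_scale/h; rewrite lerMn2r tq orbT.
have [[p ep]|hq] := pselect (exists p, p *+ d = q); last first.
  by apply: regv_scale_off => p ep; apply: hq; exists p.
by rewrite -ep in tq *; apply/regv_scale/h => //; rewrite -(ler_pMn2r hd).
Qed.

End Scaling.

Theorem theorem4p4 (K : fieldType) (n r : nat) (hn : (0 < n)%N)
    (a : 'I_n -> 'rV[int]_r) (ha : positively_multigraded a)
    (M : gmodule K a) (hM : finitely_generated M)
    (k : nat) (b : 'I_k -> 'rV[int]_r)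
    (hb : forall u, (exists2 x, component M u x & x != 0) ->
                    shifted_semigroups a b u)
    (v : 'rV[int]_r) (hv : positive_coarsening a v)
    (d : nat) (hd : (0 < d)%N) (i : nat) :
  Dset M b i (v *+ d) = Dset M b i v.
Proof.
apply/seteqP; split=> u [ub uD]; split=> //.
all: move: uD; rewrite !le_infimum_tail; apply: contra_not.
all: have E (x y : int) : x - (y - 1) - 1 = x - y
  by rewrite -addrA -opprD subrK.
all: rewrite !E dotv_scale sv_scale // cv_scale // mulrnAr -mulrnDl -mulrnBl.
all: by move/(regv_tail_scale v hd hn).
Qed.
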